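(* For $k\ge0$, $$W_{113\text{-}2}(x;k)=1+\sum_{j=0}^{k-1}\sum_{i=j}^{k-1}a_{i,j}W_{113\text{-}2}(x;k-j),$$ where $a_{i,j}$ denotes the coefficient of $y^j$ in the polynomial (in $y$) $$\frac{x\,(x^2(1-y)+y)^{i/2}}{1+y}\left(2y\,T_i\!\left(\frac{1+y}{2\sqrt{x^2(1-y)+y}}\right)+(1-y)\,U_i\!\left(\frac{1+y}{2\sqrt{x^2(1-y)+y}}\right)\right).$$
   Context: For $k\ge1$ let $[k]=\{1,\dots,k\}$; a $k$-ary word of length $n$ is an element of $[k]^n$ ($[0]^n$ is empty for $n\ge1$; the empty word is the unique word of length $0$). Two words are order-isomorphic if replacing the $i$-th smallest distinct letter by $i$ yields the same word. A word $w=w_1\cdots w_n$ contains the vincular pattern $113\text{-}2$ if there are indices $p$ and $q\ge p+3$ with $w_pw_{p+1}w_{p+2}w_q$ order-isomorphic to $1132$; otherwise it avoids it. $a_{113\text{-}2}(n,k)$ is the number of words in $[k]^n$ avoiding it, and $W_{113\text{-}2}(x;k)=\sum_{n\ge0}a_{113\text{-}2}(n,k)x^n$. $T_i$ and $U_i$ are the Chebyshev polynomials of the first and second kind: $T_0=1$, $T_1(t)=t$, $U_0=1$, $U_1(t)=2t$, and $P_i(t)=2tP_{i-1}(t)-P_{i-2}(t)$ for $i\ge2$, $P\in\{T,U\}$. An empty sum equals $0$. *)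

(* Defs.v *)
From HB Require Import structures.
From mathcomp Require Import all_boot all_order all_algebra all_field.

Set Implicit Arguments.
Unset Strict Implicit.
Unset Printing Implicit Defensive.

Import GRing.Theory.
Local Open Scope ring_scope.

(* The i-th smallest distinct letter of w is replaced by i (i >= 1). *)
Definition standardize (w : seq nat) : seq nat :=
  [seq count (fun b => (b <= a)%N) (undup w) | a <- w].

Definition order_iso (u v : seq nat) : bool := standardize u == standardize v.

(* Positions are 0-based. *)
Definition contains_113_2 (w : seq nat) : bool :=
  [exists p : 'I_(size w), exists q : 'I_(size w),
     (p + 3 <= q)%N &&
     order_iso [:: nth 0%N w p; nth 0%N w p.+1; nth 0%N w p.+2; nth 0%N w q]
               [:: 1; 1; 3; 2]%N].

(* The element a of 'I_k encodes the letter a.+1 of [k] = {1, ..., k}. *)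
Definition letters (n k : nat) (w : n.-tuple 'I_k) : seq nat :=
  [seq (val a).+1 | a <- w].

Definition avoid_113_2 (n k : nat) : nat :=
  #|[set w : n.-tuple 'I_k | ~~ contains_113_2 (letters w)]|.

(* A formal power series in x is given by its sequence of coefficients. *)
Definition fps := nat -> rat.

Definition fps_of_poly (p : {poly rat}) : fps := fun n => p`_n.

Definition fps_mul (f g : fps) : fps :=
  fun n => \sum_(m < n.+1) f m * g (n - m)%N.

Definition W_113_2 (k : nat) : fps := fun n => (avoid_113_2 n k)%:R.

Fixpoint chebyshevT (R : nzRingType) (i : nat) : {poly R} :=
  match i with
  | 0 => 1
  | i1.+1 => match i1 with
             | 0 => 'X
             | i2.+1 => 2%:R * 'X * chebyshevT R i1 - chebyshevT R i2
             end
  end.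

Fixpoint chebyshevU (R : nzRingType) (i : nat) : {poly R} :=
  match i with
  | 0 => 1
  | i1.+1 => match i1 with
             | 0 => 2%:R * 'X
             | i2.+1 => 2%:R * 'X * chebyshevU R i1 - chebyshevU R i2
             end
  end.

(* Q[x][y]: the inner variable is x and the outer one is y, so that the       *)
(* coefficient of y^j in A is A`_j, a polynomial in x.                        *)
Definition Qxy := {poly {poly rat}}.
Definition xvar : Qxy := 'X%:P.
Definition yvar : Qxy := 'X.

Definition radicand : Qxy := xvar ^+ 2 * (1 - yvar) + yvar.

(* Here r is a square root of x^2 (1 - y) + y, so r ^+ i is its (i/2)-power.  *)
Definition chebyshev_expr (L : fieldType) (x y r : L) (i : nat) : L :=
  x * r ^+ i / (1 + y) *
  (2%:R * y * (chebyshevT L i).[(1 + y) / (2%:R * r)] +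
   (1 - y) * (chebyshevU L i).[(1 + y) / (2%:R * r)]).

(* A field extension of Q(x,y) containing a square root of x^2 (1 - y) + y    *)
(* exists, so that quantifying over such extensions is not vacuous.           *)
Lemma radicand_sqrt_exists :
  exists (L : fieldType) (iota : {rmorphism Qxy -> L}) (r : L),
    injective iota /\ r ^+ 2 = iota radicand.
Proof.
pose F := {fraction Qxy}.
have inj : injective (@tofrac Qxy) by move=> a b /eqP; rewrite tofrac_eq => /eqP.
have szr : size radicand = 2%N.
  have -> : radicand = (1 - 'X^2 : {poly rat}) *: 'X + ('X^2)%:P.
    rewrite /radicand /xvar /yvar -mul_polyC polyCB polyC1 polyC_exp.
    by rewrite mulrBr mulr1 mulrBl mul1r addrC addrA addrAC.
  have nz : (1 - 'X^2 : {poly rat}) != 0.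
    by rewrite -oppr_eq0 opprB -size_poly_gt0 size_XnsubC.
  rewrite size_polyDl size_scale ?size_polyX //.
  by rewrite (leq_ltn_trans (size_polyC_leq1 _)).
pose p : {poly F} := 'X^2 - (tofrac radicand)%:P.
have szp : size p = 3%N by rewrite size_XnsubC.
have irr : irreducible_poly p.
  apply: cubic_irreducible; rewrite ?szp // => u.
  apply/negP; rewrite rootE !hornerE subr_eq0 => /eqP.
  have [[n d] /= d0 ndu] : exists2 nd : Qxy * Qxy, nd.2 != 0 &
      u * tofrac nd.2 = tofrac nd.1.
    exists (\n_(repr u), \d_(repr u)); first exact: denom_ratioP.
    rewrite -[in LHS](reprK u) /=; apply/eqP.
    rewrite !piE /= /FracField.mulf /FracField.equivf /=.
    rewrite !numden_Ratio ?(oner_eq0, mulr1, mulf_neq0, denom_ratioP) //.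
    by rewrite reprK mulrC.
  move=> /(congr1 ( *%R^~ (tofrac d ^+ 2))); rewrite -exprMn ndu.
  rewrite -!rmorphXn -rmorphM => /inj Esq.
  have r0 : radicand != 0 by rewrite -size_poly_gt0 szr.
  have n0 : n != 0.
    apply: contraTneq d0 => n0; move: Esq; rewrite n0 expr0n /= => /esym/eqP.
    by rewrite mulf_eq0 (negPf r0) expf_eq0 /= => ->.
  move/(congr1 (fun q : Qxy => odd (size q))): Esq.
  rewrite !expr2 !size_mul ?mulf_neq0 // szr.
  move: n0 d0; rewrite -!size_poly_gt0.
  case: (size n) (size d) => [|a] [|b] //= _ _.
  by rewrite !addnS /= !addnn !odd_double.
have [L _ [z rz _]] := irredp_FAdjoin irr.
exists (L : fieldType), (in_alg L \o @tofrac Qxy), z; split.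
  by apply: inj_comp inj; apply: fmorph_inj.
move: rz; rewrite rootE rmorphB /= map_polyXn map_polyC !hornerE subr_eq0.
by move/eqP.
Qed.

(* Main.v *)
Require Import Defs.
From mathcomp Require Import all_boot all_order all_algebra.
From mathcomp Require Import zify ring.

Set Implicit Arguments.
Unset Strict Implicit.
Unset Printing Implicit Defensive.

Import GRing.Theory.
Local Open Scope ring_scope.

(* Let F(k, i) be the generating function of the avoiding words over [k] that *)
(* start with the letter k - i. A word a w' with w' avoiding contains 113-2   *)
(* only if it starts with a a c, a < c, and a letter strictly between a and c *)
(* occurs later. Counting the words a a c v without such a letter over the    *)
(* alphabet from which the letters between a and c are deleted gives          *)
(*   F(k, i) = x W(k) - x^2 sum_(l < i) (F(k, l) - F(k - (i - 1 - l), l)).    *)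
(* With y acting as the shift k -> k - 1, this says F(k, i) = A_i W(k), where *)
(*   A_i = x - x^2 sum_(l < i) (1 - y^(i - 1 - l)) A_l,                       *)
(* equivalently A_0 = A_1 = x and                                             *)
(*   A_(i+2) = (1 + y) A_(i+1) - (x^2 (1 - y) + y) A_i,                       *)
(* which is the recurrence of the rescaled Chebyshev polynomials. Summing     *)
(* W(k) = 1 + sum_(i < k) F(k, i) gives the theorem.                          *)

(** The counting core of the argument above is [avoiders_fromSS]: only words starting a a c with a <
    c are constrained by their head, and deleting the letters between a and c makes these words
    avoiding words over a smaller alphabet. [avoiders_from_fpsE] turns this into F(k, i) = A_i W(k)
    by induction on i. [first_poly_sum] links the summation formula for A_i to its recurrence, which
    [first_polyE] matches with the Chebyshev expression. By [size_first_poly], A_i has y-degree at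
    most i, whence the range j <= i of the double sum. *)

Section Avoidance.
Local Open Scope nat_scope.

(** If a < b, the letter [b] itself is counted on the left only. Hence ranks determine the order of
    the letters. *)
Lemma leq_count_undup (w : seq nat) (a b : nat) : b \in w ->
  (count (leq^~ b) (undup w) <= count (leq^~ a) (undup w)) = (b <= a).
Proof.
move=> bw; case: (leqP b a) => [ba|ab].
  by apply: sub_count => c /= /leq_trans; apply.
apply/negbTE; rewrite -ltnNge.
have -> : count (leq^~ b) (undup w) =
    count (leq^~ a) (undup w) + count (fun c => a < c <= b) (undup w).
  rewrite -count_predUI [X in _ = _ + X](@eq_count _ _ pred0) ?count_pred0 ?addn0.
    by apply: eq_count => c /=; lia.
  by move=> c /=; lia.
rewrite -[X in X < _]addn0 ltn_add2l -has_count.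
by apply/hasP; exists b; rewrite ?mem_undup //= ab leqnn.
Qed.

Lemma order_iso_1132 (a b c d : nat) :
  order_iso [:: a; b; c; d] [:: 1; 1; 3; 2] = [&& a == b, a < d & d < c].
Proof.
apply/eqP/idP => [|/and3P[/eqP <- ad dc]]; last first.
  rewrite /standardize /= !inE eqxx /=.
  have -> : (a == c) = false by lia.
  have -> : (a == d) = false by lia.
  have -> : (c == d) = false by lia.
  rewrite /= !leqnn.
  have -> : c <= a = false by lia.
  have -> : d <= a = false by lia.
  have -> : a <= c by lia.
  have -> : d <= c by lia.
  have -> : a <= d by lia.
  by have -> : c <= d = false by lia.
rewrite /standardize; set w := [:: a; b; c; d].
have cmp := @leq_count_undup w.
rewrite [map _ w]/= [map _ [:: 1; 1; 3; 2]]/= => -[Ea Eb Ec Ed].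
have := cmp b a; have := cmp a b; have := cmp a d; have := cmp d c.
have := cmp c d; have := cmp d a.
rewrite Ea Eb Ec Ed !inE !eqxx !orbT /=.
by move=> /(_ isT) ? /(_ isT) ? /(_ isT) ? /(_ isT) ? /(_ isT) ? /(_ isT) ?; lia.
Qed.

Definition pattern_head (w : seq nat) : bool :=
  if w is a :: b :: c :: v then (a == b) && has (fun d => a < d < c) v
  else false.

Fixpoint avoids (w : seq nat) : bool :=
  if w is _ :: w' then ~~ pattern_head w && avoids w' else true.

Lemma contains_113_2P (w : seq nat) :
  reflect (exists p q, [/\ p + 3 <= q, q < size w, nth 0 w p = nth 0 w p.+1,
                        nth 0 w p < nth 0 w q & nth 0 w q < nth 0 w p.+2])
          (contains_113_2 w).
Proof.
apply: (iffP existsP) => [[p /existsP[q]]|[p [q [pq qw E lt1 lt2]]]].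
  rewrite order_iso_1132 => /andP[pq /and3P[/eqP E lt1 lt2]].
  by exists p, q; split.
have pw : p < size w by lia.
exists (Ordinal pw); apply/existsP; exists (Ordinal qw).
by rewrite order_iso_1132 /= pq E eqxx -E lt1 lt2.
Qed.

(** The block 113 is contiguous, so an occurrence either starts at the head or lies in the tail. *)
Lemma contains_113_2_cons (a : nat) (w : seq nat) :
  contains_113_2 (a :: w) = pattern_head (a :: w) || contains_113_2 w.
Proof.
apply/contains_113_2P/orP => [[[|p] [[|q] [pq qw E lt1 lt2]]]|[|]] //.
- have w3 : 2 < size w by move: pq qw => /=; lia.
  left; case: w w3 qw E lt1 lt2 => [|b [|c v]] //= _ qw E lt1 lt2.
  rewrite E eqxx -E; apply/(has_nthP 0); exists (q - 2); first by lia.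
  have Eq : q = (q - 2).+2 by lia.
  by rewrite Eq /= in lt1 lt2; rewrite lt1 lt2.
- by right; apply/contains_113_2P; exists p, q; split => //; lia.
- case: w => [|b [|c v]] //= /andP[/eqP <- /(has_nthP 0)[q qv /andP[lt1 lt2]]].
  by exists 0, q.+3; split => //=; lia.
- case/contains_113_2P => p [q [pq qw E lt1 lt2]].
  by exists p.+1, q.+1; split => //=; lia.
Qed.

Lemma avoidsE (w : seq nat) : avoids w = ~~ contains_113_2 w.
Proof.
elim: w => [|a w IHw]; last by rewrite contains_113_2_cons negb_or -IHw.
by apply/esym/negP => /contains_113_2P[p [q []]].
Qed.

Lemma avoids_map (f : nat -> nat) (w : seq nat) :
  {mono f : a b / a < b} -> avoids (map f w) = avoids w.
Proof.
move=> fM; elim: w => //= a w ->; congr (~~ _ && _).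
case: w => [|b [|c v]] //=; rewrite has_map.
have -> : (f a == f b) = (a == b) by have := fM a b; have := fM b a; lia.
by congr (_ && _); apply: eq_has => d /=; rewrite !fM.
Qed.

Lemma avoids_cons3 (a b c : nat) (v : seq nat) :
  avoids [:: a, b, c & v] =
  if (b == a) && (a < c) then
    avoids (c :: v) && all (fun d => ~~ (a < d < c)) v
  else avoids [:: b, c & v].
Proof.
have -> : avoids [:: a, b, c & v] =
  ~~ ((a == b) && has (fun d => a < d < c) v) && avoids [:: b, c & v] by [].
rewrite [b == a]eq_sym; case: eqP => [<-|_] //=; case: (ltnP a c) => ac.
  rewrite all_predC andbC; congr (_ && _).
  case: v => [|d v] //=; suff -> : a == c = false by [].
  by lia.
have -> : has (fun d => a < d < c) v = false; last by [].
by apply/hasP => -[d _]; lia.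
Qed.

Lemma avoids_cons2 (a c : nat) (v : seq nat) :
  a < c -> avoids [:: a, c & v] = avoids (c :: v).
Proof.
move=> ac; have -> : avoids [:: a, c & v] =
  ~~ pattern_head [:: a, c & v] && avoids (c :: v) by [].
by case: v => [|d v] //=; have -> : a == c = false by lia.
Qed.

(** * Counting words, and deleting letters from the alphabet *)

(* The sum of [P w] over the words [w] of length [n] on the letters 0..k-1. *)
Fixpoint word_sum (k n : nat) (P : seq nat -> nat) : nat :=
  if n is n'.+1 then \sum_(0 <= a < k) word_sum k n' (fun w => P (a :: w))
  else P [::].

Lemma eq_word_sum (k n : nat) (P Q : seq nat -> nat) :
  P =1 Q -> word_sum k n P = word_sum k n Q.
Proof.
elim: n P Q => [|n IHn] P Q PQ /=; first exact: PQ.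
by apply: eq_bigr => a _; apply: IHn => w; apply: PQ.
Qed.

Lemma word_sum0 (k n : nat) : word_sum k n (fun=> 0) = 0.
Proof. by elim: n => //= n IHn; rewrite big1. Qed.

Lemma word_sum_tuple (k n : nat) (P : seq nat -> nat) :
  word_sum k n P = \sum_(w : n.-tuple 'I_k) P (map val w).
Proof.
elim: n P => [|n IHn] P /=.
  rewrite (big_pred1 [tuple]) // => w.
  by rewrite (tuple0 w); apply/esym/eqP/val_inj.
rewrite big_mkord (eq_bigr _ (fun (a : 'I_k) _ => IHn (fun w => P (val a :: w)))).
rewrite pair_big /=.
rewrite [RHS](reindex (fun p : 'I_k * n.-tuple 'I_k => cons_tuple p.1 p.2)).
  by apply: eq_bigr.
exists (fun w => (thead w, behead_tuple w)) => [[a w] _|w _] /=.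
  by congr (_, _); apply: val_inj.
by rewrite [RHS]tuple_eta; apply: val_inj.
Qed.

(** The increasing injection that misses exactly the letters a + 1, ..., a + d. *)
Definition skip (a d b : nat) : nat := if b <= a then b else b + d.

Lemma skip_mono (a d : nat) : {mono skip a d : b c / b < c}.
Proof. by move=> b c; rewrite /skip; case: (leqP b a); case: (leqP c a) => ? ?; lia. Qed.

Lemma sum_skip (g : nat -> nat) (k a d : nat) : a + d < k ->
  \sum_(0 <= b < k | ~~ (a < b < a + d.+1)) g b =
  \sum_(0 <= b < k - d) g (skip a d b).
Proof.
move=> adk.
rewrite (@big_cat_nat _ _ _ a.+1) /=; [|lia|lia].
rewrite [RHS](@big_cat_nat _ _ _ a.+1) /=; [|lia|lia].
congr (_ + _).
  rewrite big_nat_cond [RHS]big_nat_cond; apply: eq_big => b; first by lia.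
  by move=> h; rewrite /skip; have -> : b <= a by lia.
rewrite (@big_cat_nat _ _ _ (a.+1 + d)) /=; [|lia|lia].
rewrite big_nat_cond big_pred0 ?add0n; last by move=> b; lia.
rewrite big_addn big_nat_cond [RHS]big_nat_cond.
apply: eq_big => b; first by lia.
by move=> h; rewrite /skip; have -> : b <= a = false by lia.
Qed.

Lemma word_sum_skip (k n a d : nat) (P : seq nat -> bool) : a + d < k ->
  word_sum k n (fun w => P w && all (fun b => ~~ (a < b < a + d.+1)) w) =
  word_sum (k - d) n (fun w => P (map (skip a d) w)).
Proof.
move=> adk; elim: n P => [|n IHn] P /=; first by rewrite andbT.
under [RHS]eq_bigr do rewrite -(IHn (fun w => P (_ :: w))).
rewrite -(sum_skip (fun b => word_sum k n (fun w =>
  P (b :: w) && all (fun b => ~~ (a < b < a + d.+1)) w)) adk).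
rewrite [RHS]big_mkcond /=; apply: eq_bigr => b _; case: ifP => hb //.
by rewrite -[RHS](word_sum0 k n); apply: eq_word_sum => w; rewrite andbF.
Qed.

Definition avoiders (n k : nat) : nat := word_sum k n avoids.

(* Length [n.+1], first letter [a] (letters are 0-based). *)
Definition avoiders_from (n k a : nat) : nat :=
  word_sum k n (fun w => avoids (a :: w)).

Lemma avoid_113_2E (n k : nat) : avoid_113_2 n k = avoiders n k.
Proof.
rewrite /avoiders word_sum_tuple /avoid_113_2 -sum1dep_card big_mkcond /=.
apply: eq_bigr => w _; rewrite -avoidsE.
have -> : letters w = map S (map val w) by rewrite -map_comp.
by rewrite avoids_map //; case: (avoids _).
Qed.

Lemma avoidersS (n k : nat) :
  avoiders n.+1 k = \sum_(0 <= a < k) avoiders_from n k a.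
Proof. by []. Qed.

(* A word [a a c v] with [a < c] avoids the pattern iff [c v] does and no     *)
(* letter of [v] lies strictly between [a] and [c]; deleting these letters    *)
(* from the alphabet turns [c] into [a + 1].                                  *)
Lemma avoiders_fromSS (n k a : nat) : a < k ->
  avoiders_from n.+2 k a + \sum_(a.+1 <= c < k) avoiders_from n k c =
  avoiders n.+2 k + \sum_(a.+1 <= c < k) avoiders_from n (k - (c - a.+1)) a.+1.
Proof.
move=> ak.
(* All four terms become sums over the second letter b and third letter c, so the identity can be
   checked termwise. *)
have pick (g : nat -> nat) : \sum_(a.+1 <= c < k) g c =
    \sum_(0 <= b < k) \sum_(0 <= c < k) (if (b == a) && (a < c) then g c else 0).
  rewrite !big_mkord (bigD1 (Ordinal ak)) //= eqxx /= [X in _ + X]big1 ?addn0.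
    by rewrite big_geq_mkord big_mkord -big_mkcond.
  move=> b; rewrite -val_eqE /= => /negbTE ->.
  by rewrite big1.
rewrite !pick /avoiders_from /avoiders /= -!big_split /=.
apply: eq_bigr => b _; rewrite -!big_split /= big_nat [RHS]big_nat.
apply: eq_bigr => c /andP[_ ck].
case: ifP => [/andP[/eqP -> ac]|nac]; last first.
  rewrite !addn0; apply: eq_word_sum => w.
  by rewrite -/(avoids [:: a, b, c & w]) avoids_cons3 nac.
(* The terms match crosswise: [a c w] avoids iff [c w] does, and [a a c w] corresponds to the
   reduced alphabet. *)
rewrite addnC; congr (_ + _).
  by apply: eq_word_sum => w; rewrite -/(avoids [:: a, c & w]) avoids_cons2.
have Ec : c = a + (c - a.+1).+1 by lia.
rewrite (@eq_word_sum _ _ _ (fun w => avoids (c :: w) &&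
    all (fun d => ~~ (a < d < a + (c - a.+1).+1)) w)).
  rewrite (@word_sum_skip k n a (c - a.+1) (fun w => avoids (c :: w))); last by lia.
  have Es : skip a (c - a.+1) a.+1 = c by rewrite /skip ltnn; lia.
  apply: eq_word_sum => w.
  rewrite -[RHS]/(nat_of_bool (avoids (a.+1 :: w))).
  by rewrite -[in RHS](avoids_map _ (@skip_mono a (c - a.+1))) map_cons Es.
move=> w; rewrite -Ec -[LHS]/(nat_of_bool (avoids [:: a, a, c & w])).
by rewrite avoids_cons3 eqxx ac.
Qed.

End Avoidance.

(** Letters are indexed from the top because deleting letters below c preserves the number of
    letters above c. *)
Lemma sum_nat_rev_top (k i : nat) (g : nat -> nat) : (i <= k)%N ->
  (\sum_(k - i <= c < k) g c = \sum_(l < i) g (k - l.+1))%N.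
Proof.
elim: i => [|i IHi] ik; first by rewrite big_ord0 subn0 big_geq.
rewrite big_ltn; last by lia.
by rewrite subnSK // IHi 1?ltnW // big_ord_recr /= addnC.
Qed.

(** * The polynomials A_i and Chebyshev polynomials *)

(* [first_poly i] is the A_i of the header. *)
Fixpoint first_poly (i : nat) : Qxy :=
  match i with
  | 0 => xvar
  | i1.+1 => match i1 with
             | 0 => xvar
             | i2.+1 => (1 + yvar) * first_poly i1 - radicand * first_poly i2
             end
  end.

Lemma first_polySS (i : nat) :
  first_poly i.+2 = (1 + yvar) * first_poly i.+1 - radicand * first_poly i.
Proof. by []. Qed.

(** With t = (1 + y) / (2r), multiplying P_(i+2) = 2t P_(i+1) - P_i by r^(i+2) turns the factor 2t
    into 2rt = 1 + y. *)
Lemma chebyshev_exprSS (L : fieldType) (x y r : L) (i : nat) :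
  r != 0 -> 2%:R != 0 :> L -> 1 + y != 0 ->
  chebyshev_expr x y r i.+2 =
  (1 + y) * chebyshev_expr x y r i.+1 - r ^+ 2 * chebyshev_expr x y r i.
Proof.
move=> r0 two0 y0; rewrite /chebyshev_expr.
have -> : chebyshevT L i.+2 = 2%:R * 'X * chebyshevT L i.+1 - chebyshevT L i by [].
have -> : chebyshevU L i.+2 = 2%:R * 'X * chebyshevU L i.+1 - chebyshevU L i by [].
rewrite -!polyC_natr !hornerD !hornerN !hornerM !hornerX !hornerC.
rewrite (exprS r i.+1) (exprS r i).
move: (r ^+ i) => ri.
move: (horner _ _) (horner _ _) (horner _ _) (horner _ _) => U1 U0 T1 T0.
by field; rewrite r0 two0 y0.
Qed.

Lemma first_polyE (L : fieldType) (iota : {rmorphism Qxy -> L}) (r : L) (i : nat) :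
  injective iota -> r ^+ 2 = iota radicand ->
  iota (first_poly i) = chebyshev_expr (iota xvar) (iota yvar) r i.
Proof.
move=> inj r2.
have iota_neq0 p : p != 0 -> iota p != 0.
  by move=> p0; rewrite -(rmorph0 iota) (inj_eq inj).
have y0 : 1 + iota yvar != 0.
  rewrite -(rmorph1 iota) -rmorphD iota_neq0 // addrC -size_poly_gt0.
  by rewrite -[1]polyC1 size_XaddC.
have two0 : 2%:R != 0 :> L.
  by rewrite -(rmorph_nat iota) iota_neq0 // -polyC_natr polyC_eq0 -polyC_natr polyC_eq0.
have r0 : r != 0.
  have : iota radicand != 0.
    apply: iota_neq0; apply/eqP => /(congr1 (horner^~ 1)).
    by rewrite /radicand /xvar /yvar !hornerE subrr mulr0 add0r => /eqP; rewrite oner_eq0.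
  by rewrite -r2 expf_eq0.
suff [] : iota (first_poly i) = chebyshev_expr (iota xvar) (iota yvar) r i /\
  iota (first_poly i.+1) = chebyshev_expr (iota xvar) (iota yvar) r i.+1 by [].
elim: i => [|i [IH0 IH1]].
  rewrite /chebyshev_expr /= -polyC_natr hornerM !hornerX -polyC1 !hornerC expr0 expr1.
  by split; field; rewrite ?r0 ?two0 ?y0.
split=> //; rewrite first_polySS rmorphB !rmorphM rmorphD rmorph1 /= -r2 IH0.
by rewrite chebyshev_exprSS // -IH1.
Qed.

Lemma first_poly_sum (i : nat) :
  first_poly i = xvar - xvar * (xvar *
    \sum_(l < i) (first_poly l - yvar ^+ (i - l.+1) * first_poly l)).
Proof.
pose B i := \sum_(l < i) first_poly l.
pose C i := \sum_(l < i) yvar ^+ (i - l.+1) * first_poly l.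
have BS j : B j.+1 = B j + first_poly j by rewrite /B big_ord_recr.
have CS j : C j.+1 = yvar * C j + first_poly j.
  rewrite /C big_ord_recr /= subnn expr0 mul1r mulr_sumr; congr (_ + _).
  by apply: eq_bigr => l _; rewrite subSn // exprS mulrA.
rewrite sumrB -/(B i) -/(C i).
suff [] : first_poly i = xvar - xvar * (xvar * (B i - C i)) /\
  first_poly i.+1 = xvar - xvar * (xvar * (B i.+1 - C i.+1)) by [].
elim: i => [|i [IH0 IH1]].
  by rewrite BS CS /B /C !big_ord0 mulr0 !add0r subrr oppr0 !mulr0 !subr0.
split=> //; rewrite first_polySS !BS !CS.
rewrite IH1 BS CS /radicand; move: IH0; move: (B i) (C i) (first_poly i).
move: xvar yvar => x y b c a Ha.
apply/eqP; rewrite -subr_eq0.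
(* Once the formula for A_(i+1) is substituted, the defect at i + 2 is y times the defect at i. *)
rewrite [X in X == 0](_ : _ = y * (x - x * (x * (b - c)) - a)); last by ring.
by rewrite -Ha subrr mulr0.
Qed.

Lemma size_first_poly (i : nat) : (size (first_poly i) <= i.+1)%N.
Proof.
elim/ltn_ind: i => i IHi; rewrite first_poly_sum.
have sx : (size xvar <= i.+1)%N by rewrite (leq_trans (size_polyC_leq1 _)).
have szx (p : Qxy) : (size p <= i.+1)%N -> (size (xvar * p)%R <= i.+1)%N.
  by move=> sp; rewrite mul_polyC (leq_trans (size_scale_leq _ _)).
have szB (p q : Qxy) : 
    (size p <= i.+1)%N -> (size q <= i.+1)%N -> (size (p - q)%R <= i.+1)%N.
  by move=> sp sq; rewrite (leq_trans (size_polyD _ _)) // size_polyN geq_max sp sq.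
apply: (szB) => //; do 2!apply: (szx).
apply: (leq_trans (size_sum _ _ _)); apply/bigmax_leqP => l _.
have sl := IHi l (ltn_ord l); have li := ltn_ord l.
apply: (szB); first by lia.
rewrite (leq_trans (size_polyMleq _ _)) // size_polyXn; lia.
Qed.

(** * The action of Q[x][y] on families of series *)

(* [P] acts on families of series [H] by letting x multiply each series and   *)
(* y replace [H k] by [H k.-1].                                               *)
Definition shift_act (P : Qxy) (H : nat -> fps) (k n : nat) : rat :=
  \sum_(j < size P) fps_mul (fps_of_poly P`_j) (H (k - j)%N) n.

Lemma shift_act_widen (P : Qxy) (H : nat -> fps) (k n m : nat) :
  (size P <= m)%N ->
  shift_act P H k n = \sum_(j < m) fps_mul (fps_of_poly P`_j) (H (k - j)%N) n.
Proof.
move=> Pm; rewrite /shift_act.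
rewrite (big_ord_widen m (fun j => fps_mul (fps_of_poly P`_j) (H (k - j)%N) n)) //.
rewrite big_mkcond /=; apply: eq_bigr => j _; case: ltnP => // Pj.
by rewrite nth_default // /fps_mul big1 // => l _; rewrite /fps_of_poly coef0 mul0r.
Qed.

Lemma shift_actD (P Q : Qxy) (H : nat -> fps) (k n : nat) :
  shift_act (P + Q) H k n = shift_act P H k n + shift_act Q H k n.
Proof.
pose m := maxn (size P) (size Q).
rewrite !(@shift_act_widen _ _ _ _ m) ?leq_maxl ?leq_maxr ?size_polyD //.
rewrite -big_split; apply: eq_bigr => j _ /=; rewrite coefD /fps_mul -big_split.
by apply: eq_bigr => l _ /=; rewrite /fps_of_poly coefD mulrDl.
Qed.

Lemma shift_act0 (H : nat -> fps) (k n : nat) : shift_act 0 H k n = 0.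
Proof. by rewrite /shift_act size_poly0 big_ord0. Qed.

Lemma shift_actB (P Q : Qxy) (H : nat -> fps) (k n : nat) :
  shift_act (P - Q) H k n = shift_act P H k n - shift_act Q H k n.
Proof. by apply/eqP; rewrite eq_sym subr_eq -shift_actD subrK. Qed.

Lemma shift_act1 (H : nat -> fps) (k n : nat) : shift_act 1 H k n = H k n.
Proof.
rewrite (@shift_act_widen _ _ _ _ 1) ?size_poly1 // big_ord1 coef1 subn0 /fps_mul.
rewrite big_ord_recl /= /fps_of_poly coef1 mul1r subn0 big1 ?addr0 // => l _.
by rewrite coef1 mul0r.
Qed.

Lemma shift_actX (P : Qxy) (H : nat -> fps) (k n : nat) :
  shift_act (xvar * P) H k n = if n is n'.+1 then shift_act P H k n' else 0.
Proof.
rewrite mul_polyC (@shift_act_widen _ _ _ _ (size P)) ?size_scale_leq //.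
case: n => [|n].
  rewrite big1 // => j _; rewrite coefZ /fps_mul big_ord1 /fps_of_poly.
  by rewrite coefXM mul0r.
apply: eq_bigr => j _; rewrite coefZ /fps_mul big_ord_recl /fps_of_poly.
rewrite coefXM mul0r add0r; apply: eq_bigr => l _.
by rewrite coefXM /= /bump.
Qed.

(** Truncation is harmless: [k.-1 - j] equals [k - j.+1] even at k = 0. *)
Lemma shift_actY (P : Qxy) (H : nat -> fps) (k n : nat) :
  shift_act (yvar * P) H k n = shift_act P H k.-1 n.
Proof.
rewrite (@shift_act_widen _ _ _ _ (size P).+1); last first.
  by rewrite (leq_trans (size_polyMleq _ _)) // size_polyX.
rewrite big_ord_recl coefXM /= [X in X + _]big1 ?add0r.
  by apply: eq_bigr => j _; rewrite coefXM /= /bump /= add1n -subn1 -subnDA.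
by move=> l _; rewrite /fps_of_poly coef0 mul0r.
Qed.

Lemma shift_actYn (P : Qxy) (H : nat -> fps) (d k n : nat) :
  shift_act (yvar ^+ d * P) H k n = shift_act P H (k - d)%N n.
Proof.
elim: d k => [|d IHd] k; first by rewrite mul1r subn0.
by rewrite exprS -mulrA shift_actY IHd -subn1 -subnDA.
Qed.

(** * From the counting identity to the generating functions *)

(* The F(k, i) of the header: the first letter k - i is [k - i.+1], 0-based. *)
Definition avoiders_from_fps (k i : nat) : fps :=
  fun n => if n is n'.+1 then (avoiders_from n' k (k - i.+1))%:R else 0.

Lemma avoiders_from_fpsE (k i n : nat) : (i < k)%N ->
  avoiders_from_fps k i n = shift_act (first_poly i) W_113_2 k n.
Proof.
elim/ltn_ind: i k n => i IHi k n ik.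
rewrite first_poly_sum shift_actB -{1}(mulr1 xvar) !shift_actX.
(* Lengths 0, 1 and 2 are settled separately, since the counting identity concerns words of at least
   three letters. *)
case: n => [|n]; first by rewrite subr0.
rewrite shift_act1 {1}/W_113_2 avoid_113_2E shift_actX; case: n => [|n]; first by rewrite subr0.
rewrite (big_morph (fun P => shift_act P W_113_2 k n) (id1 := 0) (op1 := +%R)
  (fun P Q => shift_actD P Q _ _ _) (shift_act0 _ _ _)).
have -> : \sum_(l < i) shift_act (first_poly l - yvar ^+ (i - l.+1) * first_poly l)
     W_113_2 k n =
   \sum_(l < i) (avoiders_from_fps k l n - avoiders_from_fps (k - (i - l.+1)) l n).
  apply: eq_bigr => l _; have li := ltn_ord l.
  (* The induction hypothesis also applies to the smaller alphabet: i < k gives l < k - (i -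
     l.+1). *)
  by rewrite shift_actB shift_actYn -!IHi //; lia.
case: n => [|n]; first by rewrite big1 ?subr0 // => l _; rewrite /= subrr.
have ak : (k - i.+1 < k)%N by lia.
have := avoiders_fromSS n ak; rewrite subnSK // !sum_nat_rev_top; try lia.
move=> /(congr1 (fun m => m%:R : rat)); rewrite !natrD ![(\sum_(l < i) _)%:R]natr_sum => E.
rewrite sumrB opprB addrA; apply/eqP; rewrite eq_sym subr_eq E; apply/eqP.
congr (_ + _).
apply: eq_bigr => l _; have li := ltn_ord l; congr (_%:R).
by congr avoiders_from; lia.
Qed.

Lemma W_113_2_shift_act (k n : nat) :
  W_113_2 k n =
  fps_of_poly 1 n + \sum_(0 <= i < k) shift_act (first_poly i) W_113_2 k n.
Proof.
have -> : \sum_(0 <= i < k) shift_act (first_poly i) W_113_2 k n =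
          \sum_(0 <= i < k) avoiders_from_fps k i n.
  by rewrite big_nat [RHS]big_nat; apply: eq_bigr => i ik; rewrite avoiders_from_fpsE.
rewrite /W_113_2 avoid_113_2E /fps_of_poly coef1; case: n => [|n].
  by rewrite big1 ?addr0.
rewrite add0r avoidersS -natr_sum; congr (_%:R).
have := sum_nat_rev_top (avoiders_from n k) (leqnn k).
by rewrite subnn big_mkord => ->; rewrite big_mkord.
Qed.

Theorem theorem4p5 (L : fieldType) (iota : {rmorphism Qxy -> L}) (r : L)
  (iota_inj : injective iota) (r_sqrt : r ^+ 2 = iota radicand) :
  exists A : nat -> Qxy,
    (forall i : nat,
       iota (A i) = chebyshev_expr (iota xvar) (iota yvar) r i) /\
    (forall k n : nat,
       W_113_2 k n =
         fps_of_poly 1 n +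
         \sum_(0 <= j < k) \sum_(j <= i < k)
            fps_mul (fps_of_poly (A i)`_j) (W_113_2 (k - j)) n).
Proof.
exists first_poly; split=> [i|k n]; first exact: first_polyE.
rewrite {1}W_113_2_shift_act; congr (_ + _).
under [RHS]eq_bigr do rewrite big_geq_mkord.
(* With i outermost, the inner sum over j <= i is the action of A_i, by the degree bound. *)
rewrite !big_mkord [RHS](exchange_big_dep predT) //=; apply: eq_bigr => i _.
rewrite (shift_act_widen _ _ _ (size_first_poly i)).
rewrite (big_ord_widen k (fun j =>
  fps_mul (fps_of_poly (first_poly i)`_j) (W_113_2 (k - j)) n)) //.
Qed.
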